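(* Let $(M,g)$ be an $n$-dimensional Riemannian manifold, $(B,g_B)$ a Riemannian vector bundle over $M$ and $\zeta$ a $B$-valued symmetric $(1,2)$-tensor field on $M$. Let $T$ be a curvature-like tensor field on $M$ satisfying the algebraic Gauss equation $$T(X,Y,Z,W)=g_B(\zeta(X,W),\zeta(Y,Z))-g_B(\zeta(X,Z),\zeta(Y,W))$$ for all vector fields $X,Y,Z,W$ on $M$. Let $p\in M$. Then the following statements are true. (a) For every $X\in T_p^1M$, $$\mathrm{Ric}_T(X)\le \frac14\,\|\mathrm{trace}\,\zeta\|^2 .$$ (b) A vector $X\in T_p^1M$ satisfies the equality case of the inequality in (a) if and only if $$\zeta(X,Y)=0 \ \text{ for all } Y\in T_pM \text{ such that } g(X,Y)=0, \qquad\text{and}\qquad \zeta(X,X)=\frac12\,\mathrm{trace}\,\zeta .$$ (c) The equality case of the inequality in (a) holds for all $X\in T_p^1M$ if and only if either $\zeta=0$ at $p$, or $n=2$ and, for every orthonormal basis $\{e_1,e_2\}$ of $T_pM$ and every orthonormal basis $\{e_3,\ldots,e_m\}$ of the fibre $B_p$, $$\zeta_{11}^r=\zeta_{22}^r=\frac12\left(\zeta_{11}^r+\zeta_{22}^r\right)\qquad\text{for all } r\in\{3,\ldots,m\}.$$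
   Context: A $(0,4)$-tensor field $T$ on $(M,g)$ is curvature-like if $T(X,Y,Z,W)=-T(Y,X,Z,W)$, $T(X,Y,Z,W)=-T(X,Y,W,Z)$ and $T(X,Y,Z,W)+T(X,Z,W,Y)+T(X,W,Y,Z)=0$ for all vector fields $X,Y,Z,W$. (A $(0,4)$-tensor field satisfying the algebraic Gauss equation is automatically curvature-like.) The $T$-Ricci tensor is $S_T(X,Y)=\sum_{j=1}^n T(e_j,X,Y,e_j)$ for $X,Y\in T_pM$, where $\{e_1,\ldots,e_n\}$ is any orthonormal basis of $T_pM$; the $T$-Ricci curvature is $\mathrm{Ric}_T(X)=S_T(X,X)$. The set of unit vectors in $T_pM$ is denoted $T_p^1M$. A $B$-valued symmetric $(1,2)$-tensor field $\zeta$ assigns to each $p\in M$ a symmetric bilinear map $\zeta:T_pM\times T_pM\to B_p$ (smoothly in $p$). For an orthonormal basis $\{e_1,\ldots,e_n\}$ of $T_pM$ and an orthonormal basis $\{e_{n+1},\ldots,e_m\}$ of the fibre $B_p$ (so $B$ has rank $m-n$), put $\zeta_{ij}^r=g_B(\zeta(e_i,e_j),e_r)$. Also $\mathrm{trace}\,\zeta=\sum_{i=1}^n\zeta(e_i,e_i)$ and $\|\mathrm{trace}\,\zeta\|^2=g_B(\mathrm{trace}\,\zeta,\mathrm{trace}\,\zeta)$, evaluated at $p$. *)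

(* Defs.v *)
From mathcomp Require Import all_boot all_order all_algebra.
From mathcomp Require Import all_classical all_reals all_analysis.
Import Order.TTheory GRing.Theory Num.Theory.
Import numFieldNormedType.Exports.

Set Implicit Arguments.
Unset Strict Implicit.
Unset Printing Implicit Defensive.

Local Open Scope ring_scope.
Local Open Scope classical_set_scope.

(* C^k and C^oo real functions on an open subset of R^n; values of f outside U
   are irrelevant as U is open. *)
Fixpoint Ck_on (R : realType) (n : nat) (k : nat) (U : set 'rV[R]_n)
    (f : 'rV[R]_n -> R) : Prop :=
  match k with
  | 0%N => forall x, U x -> {for x, continuous f}
  | k'.+1 => (forall x, U x -> differentiable f x) /\
             (forall a : 'I_n, Ck_on k' U (fun x => 'D_(delta_mx ord0 a) f x))
  end.

Definition Coo_on (R : realType) (n : nat) (U : set 'rV[R]_n)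
    (f : 'rV[R]_n -> R) : Prop := forall k, Ck_on k U f.

(* A homeomorphism from an open subset of M onto an open subset of R^n, given
   by total functions that are meaningful only on these subsets. *)
Record chart (R : realType) (n : nat) (M : topologicalType) := Chart {
  cdom : set M ;
  cmap : M -> 'rV[R]_n ;
  cinv : 'rV[R]_n -> M ;
  cdom_open : open cdom ;
  cimg_open : open (cmap @` cdom) ;
  cmapK : forall q, cdom q -> cinv (cmap q) = q ;
  cmap_continuous : {within cdom, continuous cmap} ;
  cinv_continuous : {within cmap @` cdom, continuous cinv} }.

(* A smooth manifold of dimension n without boundary. The atlas need not be
   maximal; chart_at picks one of its charts around each point. *)
Record manifold (R : realType) (n : nat) := Manifold {
  mspace :> topologicalType ;
  mspace_hausdorff : hausdorff_space mspace ;
  mspace_countable : @second_countable mspace ;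
  mindex : Type ;
  matlas : mindex -> chart R n mspace ;
  chart_at : mspace -> mindex ;
  chart_atP : forall q, cdom (matlas (chart_at q)) q ;
  matlas_smooth : forall (i j : mindex) (a : 'I_n),
    Coo_on (cmap (matlas i) @` (cdom (matlas i) `&` cdom (matlas j)))
           (fun x => cmap (matlas j) (cinv (matlas i) x) ord0 a) }.

Definition smooth_on (R : realType) (n : nat) (M : manifold R n) (U : set M)
    (f : M -> R) : Prop :=
  forall i : mindex M,
    Coo_on (cmap (matlas i) @` (cdom (matlas i) `&` U))
           (fun x => f (cinv (matlas i) x)).

(* A tangent vector at q is represented by its coordinates in the chart
   chart_at q; coordinates in other charts are related by the Jacobian of the
   change of charts. *)
Definition tangent (R : realType) (n : nat) (M : manifold R n) (q : M) :
  lmodType R := 'rV[R]_n.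

(* The a-th coordinate vector field of the i-th chart, defined on the domain of
   that chart. *)
Definition coord_vf (R : realType) (n : nat) (M : manifold R n)
    (i : mindex M) (a : 'I_n) (q : M) : tangent q :=
  'D_(delta_mx ord0 a) (fun x : 'rV[R]_n =>
     cmap (matlas (chart_at q)) (cinv (matlas i) x)) (cmap (matlas i) q).

(* A smooth real vector bundle of rank k, as a family of vector spaces with
   local trivializations whose transition matrices are smooth; these determine
   the topology and the smooth structure of the total space. *)
Record vector_bundle (R : realType) (n : nat) (M : manifold R n) (k : nat) :=
  VectorBundle {
    fibre : M -> lmodType R ;
    bindex : Type ;
    bdom : bindex -> set M ;
    triv : forall (i : bindex) (q : M), {linear fibre q -> 'rV[R]_k} ;
    triv_inv : forall (i : bindex) (q : M), 'rV[R]_k -> fibre q ;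
    bdom_open : forall i, open (bdom i) ;
    bdom_cover : forall q, exists i, bdom i q ;
    trivK : forall i q, bdom i q -> cancel (triv i q) (triv_inv i q) ;
    triv_invK : forall i q, bdom i q -> cancel (triv_inv i q) (triv i q) ;
    triv_smooth : forall (i j : bindex) (a b : 'I_k),
      smooth_on (bdom i `&` bdom j)
        (fun q => triv j q (triv_inv i q (delta_mx ord0 a)) ord0 b) }.

Definition local_frame (R : realType) (n : nat) (M : manifold R n) (k : nat)
    (B : vector_bundle M k) (i : bindex B) (a : 'I_k) (q : M) : fibre B q :=
  triv_inv i q (delta_mx ord0 a).

Record inner_product (R : realType) (V : lmodType R) (h : V -> V -> R) : Prop :=
  InnerProduct {
    ip_sym : forall x y, h x y = h y x ;
    ip_linear : forall x, scalar (h x) ;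
    ip_gt0 : forall x, x != 0 -> 0 < h x x }.

(* e is linearly independent because it is orthonormal. *)
Definition orthonormal_basis (R : realType) (V : lmodType R) (h : V -> V -> R)
    (k : nat) (e : 'I_k -> V) : Prop :=
  (forall i j, h (e i) (e j) = (i == j)%:R) /\
  (forall v, exists c : 'I_k -> R, v = \sum_i c i *: e i).

Record riemannian_metric (R : realType) (n : nat) (M : manifold R n) :=
  RiemannianMetric {
    metric :> forall q : M, tangent q -> tangent q -> R ;
    metric_ip : forall q, inner_product (@metric q) ;
    metric_smooth : forall (i : mindex M) (a b : 'I_n),
      smooth_on (cdom (matlas i))
        (fun q => metric (coord_vf i a q) (coord_vf i b q)) }.

Record bundle_metric (R : realType) (n : nat) (M : manifold R n) (k : nat)
    (B : vector_bundle M k) := BundleMetric {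
  bmetric :> forall q : M, fibre B q -> fibre B q -> R ;
  bmetric_ip : forall q, inner_product (@bmetric q) ;
  bmetric_smooth : forall (i : bindex B) (a b : 'I_k),
    smooth_on (bdom i)
      (fun q => bmetric (local_frame i a q) (local_frame i b q)) }.

(* Smoothness of a tensor field is smoothness of its components in coordinate
   frames of charts and local frames of trivializations. *)
Record tensor04 (R : realType) (n : nat) (M : manifold R n) := Tensor04 {
  tensor :> forall q : M,
    tangent q -> tangent q -> tangent q -> tangent q -> R ;
  tensor_linear1 : forall q (Y Z W : tangent q), scalar (fun X => tensor X Y Z W) ;
  tensor_linear2 : forall q (X Z W : tangent q), scalar (fun Y => tensor X Y Z W) ;
  tensor_linear3 : forall q (X Y W : tangent q), scalar (fun Z => tensor X Y Z W) ;
  tensor_linear4 : forall q (X Y Z : tangent q), scalar (fun W => tensor X Y Z W) ;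
  tensor_smooth : forall (i : mindex M) (a b c d : 'I_n),
    smooth_on (cdom (matlas i))
      (fun q => tensor (coord_vf i a q) (coord_vf i b q)
                       (coord_vf i c q) (coord_vf i d q)) }.

Record sym_tensor12 (R : realType) (n : nat) (M : manifold R n) (k : nat)
    (B : vector_bundle M k) := SymTensor12 {
  btensor :> forall q : M, tangent q -> tangent q -> fibre B q ;
  btensor_sym : forall q (X Y : tangent q), btensor X Y = btensor Y X ;
  btensor_linear : forall q (X : tangent q), linear (btensor X) ;
  btensor_smooth : forall (i : mindex M) (j : bindex B) (a b : 'I_n) (r : 'I_k),
    smooth_on (cdom (matlas i) `&` bdom j)
      (fun q => triv j q (btensor (coord_vf i a q) (coord_vf i b q)) ord0 r) }.

(* Both sides of the identities below are tensorial in X, Y, Z, W, so they hold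
   for all vector fields iff they hold for all tangent vectors at all points. *)
Definition curvature_like (R : realType) (n : nat) (M : manifold R n)
    (T : tensor04 M) : Prop :=
  forall (q : M) (X Y Z W : tangent q),
    [/\ T q X Y Z W = - T q Y X Z W,
        T q X Y Z W = - T q X Y W Z &
        T q X Y Z W + T q X Z W Y + T q X W Y Z = 0].

Definition gauss_equation (R : realType) (n : nat) (M : manifold R n) (k : nat)
    (B : vector_bundle M k) (gB : bundle_metric B) (zeta : sym_tensor12 B)
    (T : tensor04 M) : Prop :=
  forall (q : M) (X Y Z W : tangent q),
    T q X Y Z W = gB q (zeta q X W) (zeta q Y Z)
                - gB q (zeta q X Z) (zeta q Y W).

Section OrthonormalBases.
Variables (R : realType) (V : lmodType R) (h : V -> V -> R).
Hypothesis hip : inner_product h.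

Let hsumr x (I : finType) (c : I -> R) (e : I -> V) :
  h x (\sum_i c i *: e i) = \sum_i c i * h x (e i).
Proof.
have hD u v : h x (u + v) = h x u + h x v.
  by have := ip_linear hip x 1 u v; rewrite scale1r mul1r.
have h0 : h x 0 = 0.
  by have := hD 0 0; rewrite addr0 => /eqP; rewrite -subr_eq0 opprD addrA subrr
    sub0r oppr_eq0 => /eqP.
have hZ a u : h x (a *: u) = a * h x u.
  by have := ip_linear hip x a u 0; rewrite !addr0 h0 addr0.
by rewrite (big_morph (h x) hD h0); apply: eq_bigr => i _; rewrite hZ.
Qed.

Lemma onb_coord k (e : 'I_k -> V) : orthonormal_basis h e ->
  forall v, v = \sum_i h (e i) v *: e i.
Proof.
case=> he hs v; have [c cE] := hs v.
rewrite {1}cE; apply: eq_bigr => i _; congr (_ *: _).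
rewrite cE hsumr (bigD1 i) //= he eqxx mulr1 big1 ?addr0 // => j /negPf ji.
by rewrite he eq_sym ji mulr0.
Qed.

Lemma onb_trace_indep (W : lmodType R) (b : V -> V -> W) k l
    (e : 'I_k -> V) (f : 'I_l -> V) :
  (forall x, linear (b x)) -> (forall y, linear (b^~ y)) ->
  orthonormal_basis h e -> orthonormal_basis h f ->
  \sum_i b (e i) (e i) = \sum_i b (f i) (f i).
Proof.
move=> b2 b1 he hf.
have lin0 (g : V -> W) : linear g -> g 0 = 0.
  by move=> gl; have := gl (-1) 0 0; rewrite scaler0 addr0 scaleN1r addNr.
have linS (g : V -> W) : linear g -> forall m (c : 'I_m -> R) (u : 'I_m -> V),
    g (\sum_i c i *: u i) = \sum_i c i *: g (u i).
  move=> gl m c u.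
  rewrite (big_morph g (id1 := 0) (op1 := +%R)); last exact: lin0.
    apply: eq_bigr => i _.
    by have := gl (c i) (u i) 0; rewrite !addr0 lin0 // addr0.
  by move=> x y; have := gl 1 x y; rewrite !scale1r.
transitivity (\sum_i \sum_j h (f j) (e i) *: b (f j) (e i)).
  apply: eq_bigr => i _; rewrite {1}(onb_coord hf (e i)).
  exact: (linS (b^~ (e i))).
rewrite exchange_big /=; apply: eq_bigr => j _.
have := linS _ (b2 (f j)) _ (fun i => h (e i) (f j)) e.
rewrite -(onb_coord he) => ->.
by apply: eq_bigr => i _; rewrite (ip_sym hip).
Qed.

Lemma onb_exists n (phi : {linear V -> 'rV[R]_n}) (psi : 'rV[R]_n -> V) :
  cancel phi psi -> cancel psi phi ->
  exists e : 'I_n -> V, orthonormal_basis h e.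
Proof.
move=> phiK psiK.
have phiZ a u : phi (a *: u) = a *: phi u by exact: linearZ.
have phiS m (c : 'I_m -> R) (u : 'I_m -> V) :
  phi (\sum_i c i *: u i) = \sum_i c i *: phi (u i).
  by rewrite raddf_sum; apply: eq_bigr => i _; exact: phiZ.
have part k : (k <= n)%N ->
    exists e : 'I_k -> V, forall i j, h (e i) (e j) = (i == j)%:R.
  elim: k => [_|k IH kn]; first by exists (fun=> 0) => -[].
  have [e he] := IH (ltnW kn).
  have [x nx] : exists x : V, forall c : 'I_k -> R, x - \sum_i c i *: e i != 0.
    pose A := \matrix_(i < k) phi (e i).
    have : ~~ (1%:M <= A)%MS.
      apply/negP => /mxrankS; rewrite mxrank1 => nA.
      by have := leq_trans nA (rank_leq_row A); rewrite leqNgt kn.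
    move/row_subPn => [i ni]; exists (psi (row i 1%:M)) => c.
    apply: contra ni; rewrite subr_eq0 => /eqP E.
    rewrite -(psiK (row i 1%:M)) E phiS summx_sub // => j _.
    rewrite scalemx_sub //.
    have -> : phi (e j) = row j A by rewrite rowK.
    exact: row_sub.
  pose c i := h (e i) x.
  pose y := x - \sum_i c i *: e i.
  have y0 : y != 0 := nx c.
  have hy i : h (e i) y = 0.
    have -> : h (e i) y = - (\sum_j c j * h (e i) (e j)) + c i.
      rewrite -hsumr /y addrC -scaleN1r (ip_linear hip).
      by rewrite mulN1r.
    rewrite (bigD1 i) //= he eqxx mulr1 big1 ?addr0 ?addNr // => j /negPf ji.
    by rewrite he eq_sym ji mulr0.
  have yy : 0 < h y y := ip_gt0 hip y0.
  pose s := (Num.sqrt (h y y))^-1.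
  have hZ u a v : h u (a *: v) = a * h u v.
    by have := hsumr u (fun _ : 'I_1 => a) (fun=> v); rewrite !big_ord1.
  have hZl u a v : h (a *: u) v = a * h u v by rewrite (ip_sym hip) hZ (ip_sym hip).
  pose f (i : 'I_k.+1) := if unlift ord_max i is Some j then e j else s *: y.
  exists f => i j; rewrite /f.
  case: (unliftP ord_max i) => [i' ->|->];
    case: (unliftP ord_max j) => [j' ->|->].
  - by rewrite he (inj_eq lift_inj).
  - by rewrite hZ hy mulr0 eq_sym (negPf (neq_lift _ _)).
  - by rewrite hZl (ip_sym hip) hy mulr0 (negPf (neq_lift _ _)).
  rewrite eqxx hZ hZl mulrA /s -invfM -expr2 sqr_sqrtr ?ltW //.
  by rewrite mulVf // gt_eqF.
have [e he] := part n (leqnn n).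
exists e; split=> // v.
pose A := \matrix_(i < n) phi (e i).
have sumE (c : 'rV[R]_n) : c *m A = phi (\sum_i c ord0 i *: e i).
  rewrite mulmx_sum_row phiS; apply: eq_bigr => i _.
  by rewrite rowK.
have Afree : row_free A.
  apply/inj_row_free => c; rewrite sumE => E.
  have E0 : \sum_i c ord0 i *: e i = 0.
    by apply: (can_inj phiK); rewrite E linear0.
  apply/rowP => i; rewrite mxE.
  have := hsumr (e i) (c ord0) e; rewrite E0 (bigD1 i) //= he eqxx mulr1 big1.
    rewrite addr0 => <-.
    by have := hsumr (e i) (fun i : 'I_0 => 0) (fun=> 0); rewrite !big_ord0.
  by move=> j /negPf ji; rewrite he eq_sym ji mulr0.
have Au : A \in unitmx by rewrite -row_free_unit.
exists ((phi v *m invmx A) ord0); apply: (can_inj phiK).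
by rewrite -sumE mulmxKV.
Qed.

End OrthonormalBases.

Lemma tangent_onb_exists (R : realType) (n : nat) (M : manifold R n)
    (g : riemannian_metric M) (q : M) :
  exists e : 'I_n -> tangent q, orthonormal_basis (g q) e.
Proof. exact: (onb_exists (metric_ip g q) (phi := idfun) (psi := idfun)). Qed.

(* An arbitrary orthonormal basis of the tangent space at q; see ricci_onb and
   trace_onb below for the independence of the choice. *)
Definition tangent_onb (R : realType) (n : nat) (M : manifold R n)
    (g : riemannian_metric M) (q : M) : 'I_n -> tangent q :=
  sval (cid (tangent_onb_exists g q)).

Lemma tangent_onbP (R : realType) (n : nat) (M : manifold R n)
    (g : riemannian_metric M) (q : M) :
  orthonormal_basis (g q) (tangent_onb g q).
Proof. exact: svalP (cid (tangent_onb_exists g q)). Qed.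

Definition ricci_tensor (R : realType) (n : nat) (M : manifold R n)
    (g : riemannian_metric M) (T : tensor04 M) (q : M) (X Y : tangent q) : R :=
  \sum_(j < n) T q (tangent_onb g q j) X Y (tangent_onb g q j).

Definition Ric (R : realType) (n : nat) (M : manifold R n)
    (g : riemannian_metric M) (T : tensor04 M) (q : M) (X : tangent q) : R :=
  ricci_tensor g T X X.

Definition trace (R : realType) (n : nat) (M : manifold R n)
    (g : riemannian_metric M) (k : nat) (B : vector_bundle M k)
    (zeta : sym_tensor12 B) (q : M) : fibre B q :=
  \sum_(i < n) zeta q (tangent_onb g q i) (tangent_onb g q i).

Lemma ricci_onb (R : realType) (n : nat) (M : manifold R n)
    (g : riemannian_metric M) (T : tensor04 M) (q : M) (X Y : tangent q)
    (e : 'I_n -> tangent q) :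
  orthonormal_basis (g q) e -> ricci_tensor g T X Y = \sum_(j < n) T q (e j) X Y (e j).
Proof.
apply: (@onb_trace_indep R _ _ (metric_ip g q) R^o (fun U W => T q U X Y W)).
- by move=> U; exact: tensor_linear4.
- by move=> W; exact: tensor_linear1.
- exact: tangent_onbP.
Qed.

Lemma trace_onb (R : realType) (n : nat) (M : manifold R n)
    (g : riemannian_metric M) (k : nat) (B : vector_bundle M k)
    (zeta : sym_tensor12 B) (q : M) (e : 'I_n -> tangent q) :
  orthonormal_basis (g q) e -> trace g zeta q = \sum_(i < n) zeta q (e i) (e i).
Proof.
apply: (@onb_trace_indep R _ _ (metric_ip g q) _ (zeta q)).
- by move=> X; exact: btensor_linear.
- move=> Y a X Z; rewrite /= !(btensor_sym _ _ Y); exact: btensor_linear.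
- exact: tangent_onbP.
Qed.

Definition unit_tangent (R : realType) (n : nat) (M : manifold R n)
    (g : riemannian_metric M) (q : M) : set (tangent q) :=
  [set X | g q X X = 1].
Arguments unit_tangent {R n M} g q _.

(* The component zeta_{ij}^r with respect to the bases e and f; the index r
   numbers the basis f of the fibre from 0. *)
Definition component (R : realType) (n : nat) (M : manifold R n) (k : nat)
    (B : vector_bundle M k) (gB : bundle_metric B) (zeta : sym_tensor12 B)
    (q : M) (l : nat) (e : 'I_l -> tangent q) (f : 'I_k -> fibre B q)
    (i j : 'I_l) (r : 'I_k) : R :=
  gB q (zeta q (e i) (e j)) (f r).

(* Main.v *)
Require Import Defs.
From HB Require Import structures.
From mathcomp Require Import all_boot all_order all_algebra.
From mathcomp Require Import all_classical all_reals all_analysis.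
From mathcomp Require Import ring lra.
Import Order.TTheory GRing.Theory Num.Theory.

Set Implicit Arguments.
Unset Strict Implicit.
Unset Printing Implicit Defensive.

Local Open Scope ring_scope.
Local Open Scope classical_set_scope.

(** The whole theorem is pointwise linear algebra and follows from one identity.
    For a unit vector X and an orthonormal basis e_1, ..., e_n, the Gauss
    equation gives
      Ric_T(X) = <trace zeta, zeta(X,X)> - sum_j |zeta(X,e_j)|^2.
    Replacing each e_j by its component v_j = e_j - g(e_j,X) X orthogonal to X
    lowers the last sum by exactly |zeta(X,X)|^2 (a Pythagoras argument,
    [sum_norm_perp]), and completing the square yields
      1/4 |trace zeta|^2 - Ric_T(X)
        = |zeta(X,X) - 1/2 trace zeta|^2 + sum_j |zeta(X,v_j)|^2
    ([gauss_ricci_gap]). The right-hand side is a sum of squares, which is (a);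
    it vanishes iff every term does, and since the v_j span the orthogonal
    complement of X, this is (b). Working with the v_j rather than with an
    orthonormal basis starting at X avoids extending X to such a basis.

    For (c), if equality holds for all unit X, then zeta(e_i,e_i) is half the
    trace for every i, and summing over i gives trace zeta = n/2 trace zeta. So
    either n = 2, or the trace vanishes, and then all zeta(e_i,e_j) do by (b).
    Conversely, for n = 2 the condition on components says that zeta(e_1,e_1) =
    zeta(e_2,e_2) for every orthonormal basis; comparing a basis with a rotated
    copy of itself gives zeta(e_1,e_2) = 0 as well, so that zeta is umbilical,
    zeta = g (x) zeta(e_1,e_1) ([umbilical2]), and the criterion of (b) holds
    for every X. *)

(** * Inner products and linear combinations *)

Section LinearMaps.
Context {R : realType} {V W : lmodType R} {f : V -> W}.
Hypothesis fl : linear f.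

(* The bundled form of f gives access to the lemmas on linear maps. *)
Let F : {linear V -> W} := HB.pack f (GRing.isLinear.Build R V W *:%R f fl).

Lemma linear_sum_of (I : finType) (u : I -> V) :
  f (\sum_i u i) = \sum_i f (u i).
Proof. exact: (raddf_sum F). Qed.

Let fZ a x : f (a *: x) = a *: f x.
Proof. exact: (linearZZ F). Qed.

Lemma linear_sumZ (I : finType) (c : I -> R) (u : I -> V) :
  f (\sum_i c i *: u i) = \sum_i c i *: f (u i).
Proof. by rewrite linear_sum_of; apply: eq_bigr => i _; rewrite fZ. Qed.

Lemma linear_comb2 a x c y : f (a *: x + c *: y) = a *: f x + c *: f y.
Proof. by rewrite fl fZ. Qed.

Lemma linear_subZ a x y : f (x - a *: y) = f x - a *: f y.
Proof. by have := linear_comb2 1 x (- a) y; rewrite !scale1r !scaleNr. Qed.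

End LinearMaps.

Section InnerProduct.
Context {R : realType} {V : lmodType R} {h : V -> V -> R}.
Hypothesis hip : inner_product h.

Lemma ip_linear_r x : linear (h x : V -> R^o).
Proof. exact: ip_linear hip x. Qed.

Lemma ip_linear_l y : linear (h^~ y : V -> R^o).
Proof. by move=> a u v; rewrite /= !(ip_sym hip _ y); exact: ip_linear_r. Qed.

Lemma ip_comb2r y a u c v : h y (a *: u + c *: v) = a * h y u + c * h y v.
Proof. exact: (linear_comb2 (ip_linear_r y)). Qed.

Lemma ip_comb2l y a u c v : h (a *: u + c *: v) y = a * h u y + c * h v y.
Proof. by rewrite !(ip_sym hip _ y) ip_comb2r. Qed.

Lemma ip_subZr y u a v : h y (u - a *: v) = h y u - a * h y v.
Proof. exact: (linear_subZ (ip_linear_r y)). Qed.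

Lemma ip_subZl y u a v : h (u - a *: v) y = h u y - a * h v y.
Proof. exact: (linear_subZ (ip_linear_l y)). Qed.

Lemma ip_ge0 x : 0 <= h x x.
Proof.
have [->|/(ip_gt0 hip)/ltW //] := eqVneq x 0.
by have := ip_comb2r 0 0 0 0 0; rewrite !scale0r addr0 !mul0r addr0 => ->.
Qed.

Lemma ip_eq0 x : h x x = 0 -> x = 0.
Proof. by move=> hx; apply/eqP/negP => /negP/(ip_gt0 hip); rewrite hx ltxx. Qed.

Lemma onb_parseval n (e : 'I_n -> V) : orthonormal_basis h e ->
  forall u v, \sum_i h (e i) u * h (e i) v = h u v.
Proof.
move=> he u v; rewrite [in RHS](onb_coord hip he u).
by rewrite (linear_sumZ (ip_linear_l v)).
Qed.

Lemma onb_eq n (e : 'I_n -> V) : orthonormal_basis h e ->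
  forall u v, (forall i, h u (e i) = h v (e i)) -> u = v.
Proof.
move=> he u v huv; rewrite (onb_coord hip he u) (onb_coord hip he v).
by apply: eq_bigr => i _; rewrite !(ip_sym hip (e i)) huv.
Qed.

Lemma onb_rotate (e f : 'I_2 -> V) (a b : R) : orthonormal_basis h e ->
  a ^+ 2 + b ^+ 2 = 1 ->
  f ord0 = a *: e ord0 + b *: e ord_max ->
  f ord_max = (- b) *: e ord0 + a *: e ord_max -> orthonormal_basis h f.
Proof.
move=> he ab f0 f1.
have I2 (i : 'I_2) : i = ord0 \/ i = ord_max.
  by case: i => [[|[|//]]] ilt; [left|right]; apply: val_inj.
split=> [i j|v].
  have e00 : h (e ord0) (e ord0) = 1 by rewrite he.1.
  have e11 : h (e ord_max) (e ord_max) = 1 by rewrite he.1.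
  have e01 : h (e ord0) (e ord_max) = 0 by rewrite he.1.
  have e10 : h (e ord_max) (e ord0) = 0 by rewrite he.1.
  by case: (I2 i) => ->; case: (I2 j) => ->;
    rewrite ?f0 ?f1 !ip_comb2l !ip_comb2r ?e00 ?e01 ?e10 ?e11 ?mulr1 /= -?ab; ring.
pose x := h (e ord0) v; pose y := h (e ord_max) v.
(* The inverse rotation expresses e, hence v, in terms of f. *)
exists (fun i => if i == ord0 then a * x + b * y else a * y - b * x).
rewrite [LHS](onb_coord hip he) !big_ord_recl !big_ord0 !addr0.
have -> : lift ord0 ord0 = ord_max :> 'I_2 by apply: val_inj.
rewrite /= f0 f1 !scalerDr !scalerA addrACA -!scalerDl -/x -/y.
by congr (_ *: _ + _ *: _); rewrite -[LHS]mul1r -ab; ring.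
Qed.

End InnerProduct.

(** * Symmetric bilinear maps with values in an inner product space *)

Section VectorValuedForm.
Context {R : realType} {V W : lmodType R} {h : V -> V -> R} {k : W -> W -> R}.
Hypotheses (hip : inner_product h) (kip : inner_product k).
Context {b : V -> V -> W}.
Hypotheses (b_sym : forall X Y, b X Y = b Y X) (b_lin : forall X, linear (b X)).
Context {n : nat} {e : 'I_n -> V}.
Hypothesis he : orthonormal_basis h e.

Let tr := \sum_i b (e i) (e i).

Let perp X j := e j - h (e j) X *: X.

Lemma perp_orth X : h X X = 1 -> forall j, h X (perp X j) = 0.
Proof.
by move=> hX j; rewrite (ip_subZr hip) hX (ip_sym hip X) mulr1 subrr.
Qed.

(** The vectors perp X j span the orthogonal complement of X: such a Y is their
    combination with the coordinates h(e_j,Y) as coefficients, because the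
    multiples of X in it add up to h(Y,X) X = 0. *)
Lemma orth_null X : h X X = 1 -> (forall j, b X (perp X j) = 0) ->
  forall Y, h X Y = 0 -> b X Y = 0.
Proof.
move=> hX bX Y hXY.
have -> : Y = \sum_j h (e j) Y *: perp X j.
  under eq_bigr do rewrite scalerBr scalerA.
  rewrite sumrB -scaler_suml (onb_parseval hip he) (ip_sym hip) hXY scale0r.
  by rewrite subr0; exact: onb_coord.
rewrite (linear_sumZ (b_lin X)) big1 // => j _.
by rewrite bX scaler0.
Qed.

(** With c_j = h(e_j,X) and v_j = perp X j one has b(X,v_j) = b(X,e_j) - c_j b(X,X), while
    sum_j c_j b(X,e_j) = b(X,X) and sum_j c_j^2 = 1. *)
Lemma sum_norm_perp X : h X X = 1 ->
  \sum_j k (b X (perp X j)) (b X (perp X j)) =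
  \sum_j k (b X (e j)) (b X (e j)) - k (b X X) (b X X).
Proof.
move=> hX; set A := b X X.
have sum_cb : \sum_j h (e j) X * k A (b X (e j)) = k A A.
  rewrite -(linear_sumZ (ip_linear_r kip A)) -(linear_sumZ (b_lin X)).
  by rewrite -(onb_coord hip he).
transitivity (\sum_j (k (b X (e j)) (b X (e j))
    - 2 * (h (e j) X * k A (b X (e j))) + h (e j) X * h (e j) X * k A A)).
  apply: eq_bigr => j _; rewrite (linear_subZ (b_lin X)) -/A.
  rewrite (ip_subZr kip) !(ip_subZl kip) (ip_sym kip (b X (e j)) A); ring.
rewrite big_split sumrB -mulr_sumr sum_cb -mulr_suml (onb_parseval hip he) hX.
rewrite /=; ring.
Qed.

(** The sum on the left is the Ricci curvature of X given by the Gauss equation.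
    By linearity it is k(tr, b(X,X)) - sum_j |b(X,e_j)|^2, so this is the
    expansion of |b(X,X) - tr/2|^2 combined with [sum_norm_perp]. *)
Lemma gauss_ricci_gap X : h X X = 1 ->
  4^-1 * k tr tr
    - \sum_j (k (b (e j) (e j)) (b X X) - k (b (e j) X) (b X (e j))) =
  k (b X X - 2^-1 *: tr) (b X X - 2^-1 *: tr)
    + \sum_j k (b X (perp X j)) (b X (perp X j)).
Proof.
move=> hX; rewrite sum_norm_perp // sumrB.
under [in LHS]eq_bigr do rewrite -[k _ _]/((k^~ (b X X) : W -> R^o) _).
rewrite -(linear_sum_of (ip_linear_l kip (b X X))) -/tr.
under [X in _ - (_ - X)]eq_bigr => j _ do rewrite (b_sym (e j)).
rewrite (ip_subZr kip) !(ip_subZl kip) (ip_sym kip tr).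
by field.
Qed.

Lemma gauss_ricci_le X : h X X = 1 ->
  \sum_j (k (b (e j) (e j)) (b X X) - k (b (e j) X) (b X (e j)))
    <= 4^-1 * k tr tr.
Proof.
move=> hX; rewrite -subr_ge0 gauss_ricci_gap // addr_ge0 ?(ip_ge0 kip) //.
by apply: sumr_ge0 => j _; exact: ip_ge0.
Qed.

Lemma gauss_ricci_eq X : h X X = 1 ->
  (\sum_j (k (b (e j) (e j)) (b X X) - k (b (e j) X) (b X (e j)))
     = 4^-1 * k tr tr <->
   (forall Y, h X Y = 0 -> b X Y = 0) /\ b X X = 2^-1 *: tr).
Proof.
move=> hX; have gap := gauss_ricci_gap hX.
have sq_ge0 : 0 <= \sum_j k (b X (perp X j)) (b X (perp X j)).
  by apply: sumr_ge0 => j _; exact: ip_ge0.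
split=> [E|[bX0 bXX]].
  move: gap; rewrite E subrr => /esym/eqP.
  rewrite paddr_eq0 ?(ip_ge0 kip) // psumr_eq0 => [|j _]; last exact: ip_ge0.
  case/andP => /eqP/(ip_eq0 kip)/eqP; rewrite subr_eq0 => /eqP bXX /allP sq0.
  split=> //; apply: orth_null => // j; apply: (ip_eq0 kip).
  by apply/eqP/sq0; rewrite mem_index_enum.
apply/esym/eqP; rewrite -subr_eq0 gap bXX subrr.
have k00 : k 0 0 = 0.
  by have := ip_comb2r kip 0 0 0 0 0; rewrite scale0r addr0 !mul0r addr0.
rewrite k00 add0r big1 // => j _.
by rewrite bX0 ?k00 //; exact: perp_orth.
Qed.

(** Each b(e_i,e_i) is tr / 2, so tr = n/2 tr vanishes; then the whole matrix of
    b in the basis e does. *)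
Lemma half_trace_null : n != 2%N ->
  (forall X, h X X = 1 ->
     (forall Y, h X Y = 0 -> b X Y = 0) /\ b X X = 2^-1 *: tr) ->
  forall X Y, b X Y = 0.
Proof.
move=> n2 H.
have bee i : b (e i) (e i) = 2^-1 *: tr by apply: (H _ _).2; rewrite he.1 eqxx.
have tr0 : tr = 0.
  have /eqP : tr = (n%:R * 2^-1) *: tr.
    rewrite {1}/tr; under eq_bigr do rewrite bee.
    by rewrite sumr_const card_ord -scalerA scaler_nat.
  rewrite -subr_eq0 -{1}[tr]scale1r -scalerBl scaler_eq0 => /orP[|/eqP//].
  rewrite subr_eq0 => /eqP E; case/negP: n2.
  by rewrite -(eqr_nat R); apply/eqP; lra.
have bij i j : b (e i) (e j) = 0.
  have [->|ij] := eqVneq i j; first by rewrite bee tr0 scaler0.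
  by apply: (H (e i) _).1; rewrite he.1 ?eqxx ?(negPf ij).
have bi i Y : b (e i) Y = 0.
  rewrite (onb_coord hip he Y) (linear_sumZ (b_lin _)) big1 // => j _.
  by rewrite bij scaler0.
move=> X Y; rewrite (onb_coord hip he X) b_sym (linear_sumZ (b_lin _)).
by rewrite big1 // => j _; rewrite b_sym bi scaler0.
Qed.

End VectorValuedForm.

(** In the basis f obtained by rotating e by an angle t,
    b(f_1,f_1) - b(f_2,f_2) = cos 2t (b(e_1,e_1) - b(e_2,e_2)) + 2 sin 2t b(e_1,e_2),
    so a single angle with sin 2t nonzero shows that b(e_1,e_2) = 0. *)
Lemma umbilical2 (R : realType) (V W : lmodType R) (h : V -> V -> R)
    (b : V -> V -> W) (e : 'I_2 -> V) :
  inner_product h -> (forall X Y, b X Y = b Y X) -> (forall X, linear (b X)) ->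
  orthonormal_basis h e ->
  (forall f : 'I_2 -> V, orthonormal_basis h f ->
     b (f ord0) (f ord0) = b (f ord_max) (f ord_max)) ->
  forall X Y, b X Y = h X Y *: b (e ord0) (e ord0).
Proof.
move=> hip b_sym b_lin he H.
have diag := H e he.
have b01 : b (e ord0) (e ord_max) = 0.
  (* 3/5 and 4/5 are a rational cosine and sine. *)
  pose f (i : 'I_2) := if i == ord0 then (3/5) *: e ord0 + (4/5) *: e ord_max
                       else (- (4/5)) *: e ord0 + (3/5) *: e ord_max.
  have hf : orthonormal_basis h f.
    by apply: (@onb_rotate _ _ _ hip e f (3/5) (4/5)) => //; field.
  have bl Y a u c v : b (a *: u + c *: v) Y = a *: b u Y + c *: b v Y.
    by rewrite !(b_sym _ Y) (linear_comb2 (b_lin Y)).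
  set A := b (e ord0) (e ord0); set C := b (e ord0) (e ord_max).
  have sqE a c : b (a *: e ord0 + c *: e ord_max) (a *: e ord0 + c *: e ord_max)
               = (a ^+ 2 + c ^+ 2) *: A + (2 * a * c) *: C.
    rewrite bl !(linear_comb2 (b_lin _)) (b_sym (e ord_max) (e ord0)) -diag.
    rewrite -/A -/C !scalerDr !scalerA [X in _ + X]addrC addrACA -!scalerDl.
    by congr (_ *: _ + _ *: _); ring.
  have := H f hf; rewrite /f /= !sqE sqrrN addrC [X in _ = X]addrC.
  rewrite [(3 / 5) ^+ 2 + _]addrC => /addIr/eqP.
  rewrite -subr_eq0 -scalerBl scaler_eq0 gt_eqF => [/eqP//|]; lra.
have I2 (i : 'I_2) : i = ord0 \/ i = ord_max.
  by case: i => [[|[|//]]] ilt; [left|right]; apply: val_inj.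
have bij i j : b (e i) (e j) = (i == j)%:R *: b (e ord0) (e ord0).
  by case: (I2 i) => ->; case: (I2 j) => ->;
    rewrite /= -?diag ?(b_sym (e ord_max)) ?b01 ?scale1r ?scale0r.
have bi i Y : b (e i) Y = h (e i) Y *: b (e ord0) (e ord0).
  rewrite {1}(onb_coord hip he Y) (linear_sumZ (b_lin _)) (bigD1 i) //=.
  rewrite bij eqxx scale1r big1 ?addr0 // => j /negPf ji.
  by rewrite bij eq_sym ji scale0r scaler0.
move=> X Y; rewrite {1}(onb_coord hip he X) b_sym (linear_sumZ (b_lin _)).
under eq_bigr do rewrite b_sym bi scalerA.
by rewrite -scaler_suml (onb_parseval hip he).
Qed.

(** * The Ricci inequality and its equality cases *)

Theorem theorem2p1 (R : realType) (n : nat) (M : manifold R n)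
    (g : riemannian_metric M) (k : nat) (B : vector_bundle M k)
    (gB : bundle_metric B) (zeta : sym_tensor12 B) (T : tensor04 M)
    (hT : curvature_like T) (hGauss : gauss_equation gB zeta T) (p : M) :
  let tr := trace g zeta p in
  [/\ (forall X : tangent p, unit_tangent g p X ->
         Ric g T X <= 4^-1 * gB p tr tr),
      (forall X : tangent p, unit_tangent g p X ->
         (Ric g T X = 4^-1 * gB p tr tr <->
          (forall Y : tangent p, g p X Y = 0 -> zeta p X Y = 0) /\
          zeta p X X = 2^-1 *: tr)) &
      ((forall X : tangent p, unit_tangent g p X ->
          Ric g T X = 4^-1 * gB p tr tr) <->
       ((forall X Y : tangent p, zeta p X Y = 0) \/
        (n = 2%N /\
         forall (e : 'I_2 -> tangent p) (f : 'I_k -> fibre B p),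
           orthonormal_basis (g p) e -> orthonormal_basis (gB p) f ->
           forall r : 'I_k,
             component gB zeta e f ord0 ord0 r
               = component gB zeta e f ord_max ord_max r /\
             component gB zeta e f ord_max ord_max r
               = 2^-1 * (component gB zeta e f ord0 ord0 r
                         + component gB zeta e f ord_max ord_max r))))].
Proof.
move=> tr.
have gip := metric_ip g p; have Bip := bmetric_ip gB p.
have z_sym := @btensor_sym _ _ _ _ _ zeta p.
have z_lin := @btensor_linear _ _ _ _ _ zeta p.
have he := tangent_onbP g p.
have RicE X : Ric g T X = \sum_j
    (gB p (zeta p (tangent_onb g p j) (tangent_onb g p j)) (zeta p X X)
     - gB p (zeta p (tangent_onb g p j) X) (zeta p X (tangent_onb g p j))).
  by apply: eq_bigr => j _; exact: hGauss.
have eqP_b X : unit_tangent g p X -> (Ric g T X = 4^-1 * gB p tr tr <->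
    (forall Y : tangent p, g p X Y = 0 -> zeta p X Y = 0) /\
    zeta p X X = 2^-1 *: tr).
  by move=> hX; rewrite RicE; exact: (gauss_ricci_eq gip Bip z_sym z_lin he hX).
split=> [X hX|//|].
  by rewrite RicE; exact: (gauss_ricci_le gip Bip z_sym z_lin he hX).
split=> [H|[z0|[n2 H]] X hX].
- have [n2|n2] := eqVneq n 2%N; last first.
    left; apply: (half_trace_null gip z_sym z_lin he n2) => X hX.
    exact/(eqP_b X hX)/H.
  right; split=> // e f he2 _ r; rewrite /component.
  subst n.
  have zee i : zeta p (e i) (e i) = 2^-1 *: tr.
    have ei1 : unit_tangent g p (e i) by rewrite /unit_tangent /= he2.1 eqxx.
    exact: ((eqP_b _ ei1).1 (H _ ei1)).2.
  by rewrite !zee; split=> //; lra.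
- apply/(eqP_b X hX); split=> [Y _|]; first exact: z0.
  by rewrite /tr /trace big1 ?scaler0 // => i _; exact: z0.
- subst n; apply/(eqP_b X hX).
  have [i pi] := bdom_cover B p.
  have [f hf] := onb_exists Bip (trivK pi) (triv_invK pi).
  have umb := umbilical2 gip z_sym z_lin he (fun e he' =>
    onb_eq Bip hf (fun r => (H e f he' hf r).1)).
  split=> [Y hXY|]; first by rewrite umb hXY scale0r.
  rewrite umb hX scale1r /tr /trace !big_ord_recl big_ord0 addr0.
  rewrite [X in _ = _ *: (_ + X)]umb he.1 eqxx scale1r scalerDr -scalerDl.
  by rewrite -[LHS]scale1r; congr (_ *: _); field.
Qed.
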